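(* Let $n\in\mathbb{Z}_{\ge0}$ and $v_n>0$. If $\alpha\in(-1,0]$, then $$\kappa_-(H_\alpha(v_n))=1.$$ If $\alpha>0$, then $$\kappa_-(H_\alpha(v_n))=\begin{cases}0,&v_n\in(0,\alpha],\\1,&v_n>\alpha.\end{cases}$$
   Context: For $\alpha>-1$ and a complex sequence $u=(u_k)_{k\ge 0}$ (with $u_{-1}:=0$) put $$(\tau_\alpha u)_k=-\sqrt{k(k+\alpha)}\,u_{k-1}+(2k+1+\alpha)u_k-\sqrt{(k+1)(k+1+\alpha)}\,u_{k+1},\quad k\ge 0.$$ The discrete Laguerre operator $H_\alpha$ in $\ell^2(\mathbb{Z}_{\ge 0})$ is $H_\alpha u=\tau_\alpha u$ with domain $\{u\in\ell^2(\mathbb{Z}_{\ge0}) : \tau_\alpha u\in\ell^2(\mathbb{Z}_{\ge0})\}$; it is self-adjoint and nonnegative. With $\delta_n$ the $n$-th standard basis vector, define the rank one perturbation $$H_\alpha(v_n):=H_\alpha-v_n\langle\cdot,\delta_n\rangle\delta_n,$$ a self-adjoint operator on the domain of $H_\alpha$. $\kappa_-(A)$ denotes the total multiplicity of the negative spectrum of a self-adjoint operator $A$, i.e. the dimension of the range of its spectral projection onto $(-\infty,0)$. *)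

(* Defs.v *)
From HB Require Import structures.
From mathcomp Require Import all_boot all_order all_algebra.
From mathcomp Require Import complex.
From mathcomp Require Import all_classical all_reals all_analysis.

Set Implicit Arguments.
Unset Strict Implicit.
Unset Printing Implicit Defensive.

Import Order.TTheory GRing.Theory Num.Theory.
Import numFieldNormedType.Exports.

Local Open Scope classical_set_scope.
Local Open Scope ring_scope.
Local Open Scope complex_scope.

(* Vectors of l^2(Z_{>=0}) are plain complex sequences; membership in the
   Hilbert space is the predicate [l2]. *)
Definition l2 (R : realType) : set (nat -> R[i]) :=
  [set u | (\sum_(0 <= k <oo) (Normc.normc (u k) ^+ 2)%:E < +oo)%E].

(* <u, v> = sum_k u_k * conj v_k, linear in the first argument; the complex
   series is summed through its real and imaginary parts. *)
Definition l2dot (R : realType) (u v : nat -> R[i]) : R[i] :=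
  limn (series (fun k => complex.Re (u k * (v k)^*)))
  +i* limn (series (fun k => complex.Im (u k * (v k)^*))).

Definition l2basis (R : realType) (n : nat) : nat -> R[i] :=
  fun k => (k == n)%:R.

(* A possibly unbounded operator in l^2; [op_act] is only meaningful on
   [op_dom]. *)
Record l2_operator (R : realType) := L2Operator {
  op_dom : set (nat -> R[i]);
  op_act : (nat -> R[i]) -> (nat -> R[i]) }.

Definition laguerre_tau (R : realType) (alpha : R) (u : nat -> R[i])
    (k : nat) : R[i] :=
  - (Num.sqrt (k%:R * (k%:R + alpha)))%:C
      * (if k is j.+1 then u j else 0)
  + (2 * k%:R + 1 + alpha)%:C * u k
  - (Num.sqrt ((k%:R + 1) * (k%:R + 1 + alpha)))%:C * u k.+1.

Definition laguerre_op (R : realType) (alpha : R) : l2_operator R :=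
  L2Operator [set u | l2 u /\ l2 (laguerre_tau alpha u)] (laguerre_tau alpha).

Definition laguerre_perturbed (R : realType) (alpha : R) (n : nat) (v : R) :
    l2_operator R :=
  L2Operator (op_dom (laguerre_op alpha))
    (fun u k => op_act (laguerre_op alpha) u k
                - v%:C * l2dot u (l2basis R n) * l2basis R n k).

(* [mu] is the scalar measure B |-> <E(B) u, u>. *)
Definition diag_measure (R : realType)
    (E : set (measurableTypeR R) -> (nat -> R[i]) -> (nat -> R[i]))
    (u : nat -> R[i]) (mu : {measure set (measurableTypeR R) -> \bar R}) :
    Prop :=
  forall B, measurable B -> mu B = (complex.Re (l2dot (E B u) u))%:E.

(* Countable additivity is required of the diagonal measures <E(.) u, u>;
   by polarization this is the countable additivity of all the complex
   measures <E(.) u, w>. *)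
Record projection_valued_measure (R : realType)
    (E : set (measurableTypeR R) -> (nat -> R[i]) -> (nat -> R[i])) : Prop := {
  pvm_l2 : forall B u, measurable B -> l2 u -> l2 (E B u);
  pvm_linear : forall B (a : R[i]) u w, measurable B -> l2 u -> l2 w ->
    E B (fun k => a * u k + w k) = (fun k => a * E B u k + E B w k);
  pvm_selfadjoint : forall B u w, measurable B -> l2 u -> l2 w ->
    l2dot (E B u) w = l2dot u (E B w);
  pvm_setI : forall B C u, measurable B -> measurable C -> l2 u ->
    E (B `&` C) u = E B (E C u);
  pvm_setT : forall u, l2 u -> E setT u = u;
  pvm_measure : forall u, l2 u -> exists mu, diag_measure E u mu }.

(* A = \int x dE(x): the domain of A is { u | \int x^2 d<E u, u> < +oo } and
   <A u, u> = \int x d<E u, u> on it; over the complex numbers the quadratic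
   form determines the operator. By the spectral theorem a self-adjoint A has
   exactly one such E (on Borel sets and l^2 vectors). *)
Definition spectral_measure_of (R : realType) (A : l2_operator R)
    (E : set (measurableTypeR R) -> (nat -> R[i]) -> (nat -> R[i])) : Prop :=
  [/\ projection_valued_measure E,
      op_dom A `<=` @l2 R
    & forall u mu, l2 u -> diag_measure E u mu ->
        (op_dom A u <-> (\int[mu]_x (x ^+ 2)%:E < +oo)%E) /\
        (op_dom A u -> l2dot (op_act A u) u = (\int[mu]_x x)%R%:C)].

Definition has_dim (R : realType) (S : set (nat -> R[i])) (d : nat) : Prop :=
  exists e : 'I_d -> nat -> R[i],
    (forall c : 'I_d -> R[i],
       (forall k, \sum_(i < d) c i * e i k = 0) -> forall i, c i = 0) /\
    S = [set u | exists c : 'I_d -> R[i],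
                   forall k, u k = \sum_(i < d) c i * e i k].

(* For E the spectral measure of A, [kappa_neg_eq E d] says kappa_-(A) = d. *)
Definition kappa_neg_eq (R : realType)
    (E : set (measurableTypeR R) -> (nat -> R[i]) -> (nat -> R[i]))
    (d : nat) : Prop :=
  has_dim (E `]-oo, 0[%classic @` @l2 R) d.

(* Main.v *)
Require Import Defs.
From mathcomp Require Import all_boot all_order all_algebra.
From mathcomp Require Import complex.
From mathcomp Require Import all_classical all_reals all_analysis.
From mathcomp Require Import measurable_realfun ring lra.

Set Implicit Arguments.
Unset Strict Implicit.
Unset Printing Implicit Defensive.

Import Order.TTheory GRing.Theory Num.Theory.
Import numFieldNormedType.Exports.

Local Open Scope classical_set_scope.
Local Open Scope ring_scope.
Local Open Scope complex_scope.

(** Write H for the perturbed operator.  Two facts about its quadratic form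
    decide the answer.

    Lower bound: <H u, u> >= (alpha - v) |u_n|^2 on the whole domain, for every
    alpha > -1.  The form of the Laguerre matrix can be completed to
    squares in two ways, with sqrt(k+1+alpha) u_k - sqrt(k+1) u_(k+1) or with
    sqrt(k+1) u_k - sqrt(k+1+alpha) u_(k+1); using the first kind below n and
    the second kind from n on leaves exactly alpha |u_n|^2 over.  For finite
    sums there is also a boundary term (form_lower_bound), which cannot keep a
    negative limit, as N |u_N|^2 would then grow linearly, against square
    summability (no_harmonic_growth, laguerre_form_ge).

    Sharpness: if alpha <= 0 or alpha < v, some finitely supported u has
    <H u, u> < 0.  Let h be the solution of tau h = 0 with h_0 = 1.  Then
    h_k^2 = prod_(j < k) (j+1+alpha)/(j+1), and in terms of p = u / h the
    Laguerre form is that of a chain of resistors in which the link between k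
    and k+1 has conductance (k+1+alpha) h_k^2.  The best p is a potential
    which is constant up to n and then falls to 0 along the chain; for it the
    quotient <H u, u> / |u_n|^2 is 1/(h_n^2 T) - v, with T the resistance of
    the links used.  Divergence of the harmonic series brings 1/(h_n^2 T)
    below v (resistance_large, exists_negative_energy).

    The rest holds for any operator A with spectral measure E.  Vectors in the
    range of E]-b, 0[ lie in the domain and, when nonzero, have <A f, f> < 0
    (bounded_spectral_vector); conversely <A u, u> < 0 forces E]-oo, 0[ u to be
    nonzero (negative_energy_spectral).  If the form is nonnegative, the
    negative spectral subspace is therefore 0 (kappa_neg_eq0).  If it is
    nonnegative on vectors with u_n = 0 and somewhere negative, the subspace is
    a line: two independent bounded spectral vectors would have a nonzero
    combination vanishing at n (kappa_neg_eq1).  Passing from the intervals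
    ]-m, 0[ to ]-oo, 0[ is continuity of the diagonal measures
    (pvm_bounded_itv_eq0). *)

(** * Square summable sequences *)

Definition abs2 (R : realType) (z : R[i]) : R :=
  complex.Re z ^+ 2 + complex.Im z ^+ 2.

Lemma abs2_ge0 (R : realType) (z : R[i]) : 0 <= abs2 z.
Proof. by rewrite addr_ge0 ?sqr_ge0. Qed.

Lemma abs2_eq0 (R : realType) (z : R[i]) : abs2 z <= 0 -> z = 0.
Proof.
case: z => a b; rewrite /abs2 /= => h.
by have [-> ->] : a = 0 /\ b = 0 by split; nra.
Qed.

Lemma Re_mulJ (R : realType) (z w : R[i]) :
  complex.Re (z * w^*) =
  complex.Re z * complex.Re w + complex.Im z * complex.Im w.
Proof. by case: z w => [a b] [c d] /=; ring. Qed.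

Lemma Re_mulJ_self (R : realType) (z : R[i]) : complex.Re (z * z^*) = abs2 z.
Proof. by rewrite Re_mulJ -!expr2. Qed.

Lemma l2P (R : realType) (u : nat -> R[i]) :
  l2 u <-> cvgn (series (fun k => abs2 (u k))).
Proof.
have E k : Normc.normc (u k) ^+ 2 = abs2 (u k).
  by case: (u k) => a b; rewrite sqr_sqrtr// addr_ge0 ?sqr_ge0.
have -> : l2 u = ((\sum_(0 <= k <oo) (abs2 (u k))%:E < +oo)%E : Prop).
  by rewrite /l2 /=; under eq_eseriesr do rewrite E.
split=> [|cu]; first by apply: nnseries_is_cvg => k; exact: abs2_ge0.
have -> : (\sum_(0 <= k <oo) (abs2 (u k))%:E)%E =
          (limn (series (fun k => abs2 (u k))))%:E.
  rewrite -EFin_lim//; congr (limn _); apply/funext => N /=.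
  by rewrite /series /= sumEFin.
exact: ltry.
Qed.

Lemma l2_cvg_Re_mulJ (R : realType) (u w : nat -> R[i]) : l2 u -> l2 w ->
  cvgn (series (fun k => complex.Re (u k * (w k)^*))).
Proof.
move=> /l2P cu /l2P cw; apply: normed_cvg.
apply: (@series_le_cvg _ _ (fun k => abs2 (u k) + abs2 (w k))) => //.
- by move=> k /=.
- by move=> k; apply: addr_ge0; exact: abs2_ge0.
- move=> k /=; rewrite Re_mulJ; case: (u k) (w k) => [a b] [c d].
  rewrite /abs2 /= ler_norml.
  have := sqr_ge0 (a + c); have := sqr_ge0 (b + d).
  have := sqr_ge0 (a - c); have := sqr_ge0 (b - d).
  have := sqr_ge0 a; have := sqr_ge0 b; have := sqr_ge0 c; have := sqr_ge0 d.
  by move=> *; apply/andP; split; lra.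
- exact: (is_cvg_seriesD cu cw).
Qed.

Lemma l2_lin (R : realType) (a : R[i]) (u w : nat -> R[i]) :
  l2 u -> l2 w -> l2 (fun k => a * u k + w k).
Proof.
move=> /l2P cu /l2P cw; apply/l2P.
apply: (@series_le_cvg _ _
  (fun k => (2 * abs2 a) * abs2 (u k) + 2 * abs2 (w k))).
- by move=> k; exact: abs2_ge0.
- by move=> k; rewrite addr_ge0 ?mulr_ge0 ?abs2_ge0.
- move=> k; case: a (u k) (w k) => [a b] [c d] [e f]; rewrite /abs2 /=.
  have := sqr_ge0 ((a * c - b * d) - e); have := sqr_ge0 ((a * d + b * c) - f).
  lra.
- have cu' := @is_cvg_seriesZ _ _ (2 * abs2 a) cu.
  have cw' := @is_cvg_seriesZ _ _ 2 cw.
  exact: (is_cvg_seriesD cu' cw').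
Qed.

Lemma l2_0 (R : realType) : l2 (fun _ : nat => 0 : R[i]).
Proof.
apply/l2P; rewrite (_ : series _ = fun=> 0); first exact: is_cvg_cst.
apply/funext => N; rewrite /series /= big1// => k _.
by rewrite /abs2 /= expr0n addr0.
Qed.

Lemma l2_scale (R : realType) (a : R[i]) (u : nat -> R[i]) :
  l2 u -> l2 (fun k => a * u k).
Proof.
by move=> lu; have := l2_lin a lu (@l2_0 R); under eq_fun do rewrite addr0.
Qed.

Lemma l2_finite_support (R : realType) (u : nat -> R[i]) (N : nat) :
  (forall k, (N <= k)%N -> u k = 0) -> l2 u.
Proof.
move=> u0; apply/l2P; apply/cvg_ex.
exists (series (fun k => abs2 (u k)) N); apply: cvg_near_cst.
near=> M; have NM : (N <= M)%N by near: M; exists N.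
rewrite /series /= (big_cat_nat _ NM)//= [X in _ + X]big_nat_cond.
rewrite [X in _ + X]big1 ?addr0// => k /andP[/andP[Nk _] _].
by rewrite u0// /abs2 /= expr0n addr0.
Unshelve. all: by end_near. Qed.

Lemma l2dot_self_eq0 (R : realType) (u : nat -> R[i]) : l2 u ->
  complex.Re (l2dot u u) = 0 -> u = fun=> 0.
Proof.
move=> lu; rewrite /l2dot /=; under eq_fun do rewrite Re_mulJ_self.
move=> u0; apply/funext => k; apply: abs2_eq0; rewrite -u0.
have nd : nondecreasing_seq (series (fun k => abs2 (u k))).
  by apply/nondecreasing_seqP => m; rewrite seriesSr lerDl abs2_ge0.
apply: le_trans (nondecreasing_cvgn_le nd _ k.+1); last exact/l2P.
rewrite seriesSr lerDr; apply: sumr_ge0 => *; exact: abs2_ge0.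
Qed.

Lemma limn_series_finite (R : realType) (f : R ^nat) (N : nat) :
  (forall k, (N <= k)%N -> f k = 0) -> limn (series f) = series f N.
Proof.
move=> f0; apply/cvg_lim => //; apply: cvg_near_cst.
near=> M; have NM : (N <= M)%N by near: M; exists N.
rewrite /series /= (big_cat_nat _ NM)//= [X in _ + X]big_nat_cond.
by rewrite [X in _ + X]big1 ?addr0// => k /andP[/andP[Nk _] _]; exact: f0.
Unshelve. all: by end_near. Qed.

Lemma l2dot_basis (R : realType) (u : nat -> R[i]) (n : nat) :
  l2dot u (l2basis R n) = u n.
Proof.
have b0 k : k != n -> u k * (l2basis R n k)^* = 0.
  move=> /negbTE kn; have -> : l2basis R n k = 0 by rewrite /l2basis kn.
  by rewrite rmorph0 mulr0.
have bn : u n * (l2basis R n n)^* = u n.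
  have -> : l2basis R n n = 1 by rewrite /l2basis eqxx.
  by rewrite rmorph1 mulr1.
rewrite /l2dot !(@limn_series_finite _ _ n.+1).
- rewrite /series /= !big_nat_recr//= bn.
  rewrite !big1_seq ?add0r; first by case: (u n).
  + by move=> k; rewrite mem_index_iota => /andP[_ kn]; rewrite b0// ltn_eqF.
  + by move=> k; rewrite mem_index_iota => /andP[_ kn]; rewrite b0// ltn_eqF.
- by move=> k kn; rewrite b0// gtn_eqF.
- by move=> k kn; rewrite b0// gtn_eqF.
Qed.

(** * Integrals of the identity over the negative half-line *)

(** For a measure carried by a bounded interval below 0 the identity function
    is square integrable, and its integral is negative unless the measure
    vanishes: an integral of |x| equal to 0 would make x = 0 almost everywhere
    on a set which does not contain 0. *)
Lemma Rintegral_lt0_bounded_itv (R : realType)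
    (mu : {measure set (measurableTypeR R) -> \bar R}) (b : R) :
  let B := `]-b, 0[%classic in 0 <= b ->
  (mu B < +oo)%E -> mu (~` B) = 0%E ->
  (\int[mu]_x (x ^+ 2)%:E < +oo)%E /\ (mu B != 0%E -> (\int[mu]_x x)%R < 0).
Proof.
move=> B b0 muB muNB.
have mB : measurable B by exact: measurable_itv.
have mNB : measurable (~` B) by exact: measurableC.
have finB : mu B \is a fin_num by rewrite ge0_fin_numE.
have splitB (f : R -> R) : measurable_fun setT f ->
    (\int[mu]_x (f x)%:E = \int[mu]_(x in B) (f x)%:E)%E.
  move=> mf; rewrite -(setUv B) integral_setU//.
  - rewrite [X in (_ + X)%E]null_set_integral ?adde0//.
    apply/measurable_EFinP; exact: measurable_funTS.
  - rewrite setUv; exact/measurable_EFinP.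
  - by rewrite disj_set2E setICr.
split.
  rewrite (splitB (fun x => x ^+ 2)); last exact: measurable_funX.
  apply: (@le_lt_trans _ _ (\int[mu]_(x in B) (b^+2)%:E)%E).
    apply: ge0_le_integral => //.
    - by move=> x _; rewrite lee_fin sqr_ge0.
    - apply/measurable_EFinP; apply: measurable_funTS; exact: measurable_funX.
    - move=> x; rewrite /B/= in_itv/= lee_fin => /andP[]; nra.
  rewrite integral_cst//; by rewrite -(fineK finB) -EFinM ltry.
move=> muB0; rewrite /Rintegral.
rewrite [X in fine X](splitB id)//.
have -> : (\int[mu]_(x in B) x%:E = - \int[mu]_(x in B) `|x%:E|)%E.
  rewrite -integral_ge0N//; apply: eq_integral => x.
  rewrite inE /B/= in_itv/= => /andP[_ x0].
  by rewrite ltr0_norm// opprK.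
have mE : measurable_fun B (EFin : R -> \bar R) by apply/measurable_EFinP.
rewrite fineN oppr_lt0; apply: fine_gt0; apply/andP; split.
  rewrite lt_def integral_ge0// andbT; apply: contra muB0 => /eqP.
  move=> /(ae_eq_integral_abs mu mB mE) [N [mN muN sN]].
  rewrite -measure_le0 -muN le_measure ?inE// => x Bx.
  apply: sN => /= /(_ Bx) [x0]; move: Bx.
  by rewrite /B/= in_itv/= x0 ltxx andbF.
apply: (@le_lt_trans _ _ (\int[mu]_(x in B) b%:E)%E).
  apply: ge0_le_integral => //.
  - exact: measurableT_comp.
  - move=> x; rewrite /B/= in_itv/= lee_fin => /andP[h1 h2].
    by rewrite ltr0_norm//; lra.
rewrite integral_cst//; by rewrite -(fineK finB) -EFinM ltry.
Qed.

Lemma Rintegral_ge0_null (R : realType)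
    (mu : {measure set (measurableTypeR R) -> \bar R}) :
  mu `]-oo, 0[%classic = 0%E -> 0 <= (\int[mu]_x x)%R.
Proof.
move=> mu0.
have mB : measurable (`]-oo, 0[%classic : set (measurableTypeR R)).
  by exact: measurable_itv.
have mE : measurable_fun setT (EFin : measurableTypeR R -> \bar R).
  by apply/measurable_EFinP.
rewrite /Rintegral -(setUv `]-oo, 0[%classic) integral_setU//.
- rewrite null_set_integral ?add0e//.
  apply: fine_ge0; apply: integral_ge0 => x /=.
  by rewrite in_itv/= lee_fin => /negP; rewrite -leNgt.
- exact: measurableC.
- by rewrite disj_set2E setICr.
Qed.

Lemma itvNy0_bigcup (R : realType) :
  `]-oo, 0[%classic = \bigcup_m `]-m%:R, 0[%classic :> set (measurableTypeR R).
Proof.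
apply/seteqP; split=> x /=; rewrite ?in_itv/=; last first.
  by move=> [m _]; rewrite /= in_itv/= => /andP[].
move=> x0; exists (Num.truncn `|x|).+1 => //=; rewrite in_itv/= x0 andbT.
by rewrite ltrNl -(ltr0_norm x0) truncnS_gt.
Qed.

Lemma bounded_itv_null (R : realType)
    (mu : {measure set (measurableTypeR R) -> \bar R}) :
  (forall m, mu `]-m%:R, 0[%classic = 0%E) -> mu `]-oo, 0[%classic = 0%E.
Proof.
move=> h; apply/negligibleP; first exact: measurable_itv.
rewrite itvNy0_bigcup; apply: negligible_bigcup => m.
apply/negligibleP; [exact: measurable_itv|exact: h].
Qed.

(** * Negative spectral subspace of an operator *)

Section ProjectionValuedMeasure.
Variables (R : realType)
  (E : set (measurableTypeR R) -> (nat -> R[i]) -> (nat -> R[i])).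
Hypothesis pvmE : projection_valued_measure E.
Implicit Types (B C : set (measurableTypeR R)) (u w : nat -> R[i]).

Lemma pvm_subl B C u : measurable B -> measurable C -> B `<=` C -> l2 u ->
  E B (E C u) = E B u.
Proof. by move=> mB mC BC lu; rewrite -(pvm_setI pvmE)// setIidl. Qed.

Lemma pvm_subr B C u : measurable B -> measurable C -> B `<=` C -> l2 u ->
  E C (E B u) = E B u.
Proof. by move=> mB mC BC lu; rewrite -(pvm_setI pvmE)// setIidr. Qed.

(** The measure of B is the squared norm of E B u, as E B is a self-adjoint
    idempotent. *)
Lemma pvm_eq0P B u (mu : {measure set (measurableTypeR R) -> \bar R}) :
  measurable B -> l2 u -> diag_measure E u mu ->
  mu B = 0%E <-> E B u = fun=> 0.
Proof.
move=> mB lu /(_ B mB) ->; have lEu := pvm_l2 pvmE mB lu.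
have -> : complex.Re (l2dot (E B u) u) = complex.Re (l2dot (E B u) (E B u)).
  rewrite -[in LHS](pvm_subl mB mB (@subset_refl _ B) lu).
  by rewrite (pvm_selfadjoint pvmE).
split=> [[]|->]; first exact: l2dot_self_eq0.
rewrite /= (@limn_series_finite _ _ 0); first by rewrite /series /= big_geq.
by move=> k _; rewrite !mul0r subr0.
Qed.

Lemma pvm_scaleB B (a : R[i]) u w : measurable B -> l2 u -> l2 w ->
  E B (fun k => w k - a * u k) = (fun k => E B w k - a * E B u k).
Proof.
move=> mB lu lw; have := pvm_linear pvmE (- a) mB lu lw.
under eq_fun do rewrite mulNr addrC.
by move=> ->; apply/funext => k; rewrite mulNr addrC.
Qed.

Lemma pvm_0 B : measurable B -> E B (fun=> 0) = fun=> 0.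
Proof.
move=> mB; have := pvm_scaleB 1 mB (@l2_0 R) (@l2_0 R).
under eq_fun do rewrite mulr0 subr0.
by move=> ->; apply/funext => k; rewrite mul1r subrr.
Qed.

Lemma pvm_scale B (a : R[i]) u : measurable B -> l2 u ->
  E B (fun k => a * u k) = fun k => a * E B u k.
Proof.
move=> mB lu; have := pvm_linear pvmE a mB lu (@l2_0 R).
under eq_fun do rewrite addr0.
by move=> ->; rewrite (pvm_0 mB); apply/funext => k; rewrite addr0.
Qed.

Lemma pvm_set0 u : l2 u -> E set0 u = fun=> 0.
Proof.
move=> lu; have [mu dmu] := pvm_measure pvmE lu.
by apply/(pvm_eq0P measurable0 lu dmu); exact: measure0.
Qed.

(** Countable additivity of the diagonal measure of u carries the vanishing
    from the bounded intervals to their union. *)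
Lemma pvm_bounded_itv_eq0 u : l2 u ->
  (forall m : nat, E `]-m%:R, 0[%classic u = fun=> 0) ->
  E `]-oo, 0[%classic u = fun=> 0.
Proof.
move=> lu h; have [mu dmu] := pvm_measure pvmE lu.
apply/(pvm_eq0P (measurable_itv _) lu dmu); apply: bounded_itv_null => m.
exact/(pvm_eq0P (measurable_itv _) lu dmu).
Qed.

End ProjectionValuedMeasure.

Section NegativeSpectralSubspace.
Variables (R : realType) (A : l2_operator R)
  (E : set (measurableTypeR R) -> (nat -> R[i]) -> (nat -> R[i])).
Hypothesis hE : spectral_measure_of A E.

Let pvmE : projection_valued_measure E. Proof. by case: hE. Qed.

(** The diagonal measure of f is carried by ]-b, 0[ because E (~` ]-b, 0[) f
    is E set0 u = 0. *)
Lemma bounded_spectral_vector (b : R) (u : nat -> R[i]) : 0 <= b -> l2 u ->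
  let f := E `]-b, 0[%classic u in
  op_dom A f /\ (f <> (fun=> 0) -> complex.Re (l2dot (op_act A f) f) < 0).
Proof.
move=> b0 lu f; have [_ _ hA] := hE.
pose B : set (measurableTypeR R) := `]-b, 0[%classic.
have mB : measurable B by exact: measurable_itv.
have mNB : measurable (~` B) by exact: measurableC.
have lf : l2 f by exact: (pvm_l2 pvmE).
have [mu dmu] := pvm_measure pvmE lf.
have [domE actE] := hA _ _ lf dmu.
have muNB : mu (~` B) = 0%E.
  apply/(pvm_eq0P pvmE mNB lf dmu).
  by rewrite /f -(pvm_setI pvmE)// setICl; exact: (pvm_set0 pvmE).
have muB : (mu B < +oo)%E by rewrite dmu// ltry.
have [x2 xneg] := Rintegral_lt0_bounded_itv b0 muB muNB.
have df : op_dom A f by exact/domE.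
split=> // f0; rewrite actE//=; apply: xneg; apply/eqP.
move=> /(pvm_eq0P pvmE mB lf dmu) fB; apply: f0; rewrite -fB.
by rewrite /f (pvm_subl pvmE).
Qed.

(** Otherwise the diagonal measure of u would be carried by [0, +oo[, and the
    integral of x would be nonnegative. *)
Lemma negative_energy_spectral (u : nat -> R[i]) : op_dom A u ->
  complex.Re (l2dot (op_act A u) u) < 0 -> E `]-oo, 0[%classic u <> fun=> 0.
Proof.
move=> du neg Pu0; have [_ dl2 hA] := hE; have lu := dl2 _ du.
have [mu dmu] := pvm_measure pvmE lu; have [_ /(_ du) actE] := hA _ _ lu dmu.
move: neg; rewrite actE /= ltNge; apply/negP/negPn.
apply: Rintegral_ge0_null.
exact/(pvm_eq0P pvmE (measurable_itv _) lu dmu).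
Qed.

Lemma kappa_neg_eq0 :
  (forall u, op_dom A u -> 0 <= complex.Re (l2dot (op_act A u) u)) ->
  kappa_neg_eq E 0.
Proof.
move=> pos.
have P0 u : l2 u -> E `]-oo, 0[%classic u = fun=> 0.
  move=> lu; apply: (pvm_bounded_itv_eq0 pvmE) => // m; apply: contrapT => f0.
  have [df /(_ f0)] := bounded_spectral_vector (ler0n R m) lu.
  by rewrite ltNge pos.
exists (fun=> fun=> 0); split; first by move=> c _ [].
apply/seteqP; split=> w.
  by move=> [u lu <-]; exists (fun=> 0) => k; rewrite big_ord0 P0.
move=> [c wE]; exists (fun=> 0); first exact: l2_0.
by rewrite P0; [apply/funext => k; rewrite wE big_ord0|exact: l2_0].
Qed.

(** A nonzero vector e in the range of some E]-m0, 0[ has a negative form, so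
    e_n <> 0.  For m >= m0 every vector in the range of E]-m, 0[ minus the
    multiple of e with the same coordinate n has a nonnegative form, so it is
    0: this range is the line of e.  The projection of w onto it does not
    depend on m >= m0, so it is also E]-oo, 0[ w. *)
Lemma kappa_neg_eq1 (n : nat) :
  (forall u, op_dom A u -> u n = 0 ->
    0 <= complex.Re (l2dot (op_act A u) u)) ->
  (exists2 u, op_dom A u & complex.Re (l2dot (op_act A u) u) < 0) ->
  kappa_neg_eq E 1.
Proof.
move=> pos [u du neg]; have [_ dl2 _] := hE; have lu := dl2 _ du.
pose I (m : nat) : set (measurableTypeR R) := `]-m%:R, 0[%classic.
pose N : set (measurableTypeR R) := `]-oo, 0[%classic.
have mI m : measurable (I m) by exact: measurable_itv.
have mN : measurable N by exact: measurable_itv.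
have IN m : I m `<=` N by move=> x; rewrite /I /N/= !in_itv/= => /andP[].
have Imono m m' : (m <= m')%N -> I m `<=` I m'.
  move=> mm' x; rewrite /I /= !in_itv/= => /andP[h ->]; rewrite andbT.
  by apply: le_lt_trans h; rewrite lerN2 ler_nat.
have bounded m w : l2 w -> op_dom A (E (I m) w) /\
    (E (I m) w <> (fun=> 0) ->
     complex.Re (l2dot (op_act A (E (I m) w)) (E (I m) w)) < 0).
  by move=> lw; exact: bounded_spectral_vector.
have [m0 e0] : exists m, E (I m) u <> fun=> 0.
  apply: contrapT => none; apply: (negative_energy_spectral du neg).
  apply: (pvm_bounded_itv_eq0 pvmE) => // m; apply: contrapT => ne0.
  by apply: none; exists m.
pose e := E (I m0) u.
have le : l2 e by exact: (pvm_l2 pvmE).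
have [de /(_ e0) ene] := bounded m0 u lu.
have en0 : e n != 0.
  by apply/eqP => en; have := pos _ de en; rewrite leNgt ene.
have Ie m : (m0 <= m)%N -> E (I m) e = e.
  by move=> mm; rewrite /e (pvm_subr pvmE)//; exact: Imono.
have lz (c : R[i]) w : l2 w -> l2 (fun k => w k - c * e k).
  move=> lw; have := l2_lin (- c) le lw.
  by under eq_fun do rewrite mulNr addrC.
have multiple m w : (m0 <= m)%N -> l2 w ->
    E (I m) w = fun k => E (I m) w n / e n * e k.
  move=> mm lw; set c := E (I m) w n / e n.
  have [df fneg] := bounded m _ (lz c w lw).
  have fE : E (I m) (fun k => w k - c * e k) =
            fun k => E (I m) w k - c * e k by rewrite (pvm_scaleB pvmE)// Ie.
  have f0 : E (I m) (fun k => w k - c * e k) = fun=> 0.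
    apply: contrapT => /fneg; rewrite ltNge => /negP; apply; apply: pos => //.
    by rewrite fE /c divfK// subrr.
  apply/funext => k; apply/eqP; rewrite -subr_eq0; apply/eqP.
  by rewrite -[LHS](congr1 (fun g => g k) fE) f0.
have spanned w : l2 w -> exists c, E N w = fun k => c * e k.
  move=> lw; pose c := E (I m0) w n / e n; exists c.
  pose z k := w k - c * e k; have lzw : l2 z by exact: lz.
  (* c e is the component of w in the line, and z the rest of w; it remains to
     see that z has no negative spectral part at all. *)
  have z0 : E (I m0) z = fun=> 0.
    rewrite /z (pvm_scaleB pvmE)// Ie//; apply/funext => k.
    by rewrite {1}(multiple m0 w)// subrr.
  have Nz : E N z = fun=> 0.
    apply: (pvm_bounded_itv_eq0 pvmE) => // m; rewrite -/(I m).
    have [mm|mm] := leqP m0 m; last first.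
      rewrite -(pvm_subl pvmE (mI m) (mI m0))//; last exact/Imono/ltnW.
      by rewrite z0 (pvm_0 pvmE).
    have := pvm_subl pvmE (mI m0) (mI m) (Imono _ _ mm) lzw.
    rewrite z0 (multiple m z)//; set d := _ / _ => de0.
    by rewrite -de0 (pvm_scale pvmE)// Ie.
  move: Nz; rewrite /z (pvm_scaleB pvmE)// /e (pvm_subr pvmE)// -/e => Nz.
  apply/funext => k; apply/eqP; rewrite -subr_eq0; apply/eqP.
  exact: (congr1 (fun g => g k) Nz).
exists (fun=> e); split.
  move=> c ce0 i; have /eqP := ce0 n; rewrite big_ord1 mulf_eq0 (negbTE en0).
  by rewrite orbF => /eqP c0; rewrite (ord1 i).
apply/seteqP; split=> [x [w lw <-]|x [c xE]].
  by have [c ->] := spanned w lw; exists (fun=> c) => k; rewrite big_ord1.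
exists (fun k => c ord0 * e k); first exact: l2_scale.
have NE : E N e = e by rewrite /e (pvm_subr pvmE).
by rewrite (pvm_scale pvmE)// NE; apply/funext => k; rewrite xE big_ord1.
Qed.

End NegativeSpectralSubspace.

(** * Lower bound for the perturbed Laguerre form *)

(** The coefficients of tau are real, so tau acts separately on real and
    imaginary parts; this is its action on a real sequence. *)
Definition laguerre_tau_re (R : realType) (alpha : R) (x : nat -> R)
    (k : nat) : R :=
  - Num.sqrt (k%:R * (k%:R + alpha)) * (if k is j.+1 then x j else 0)
  + (2 * k%:R + 1 + alpha) * x k
  - Num.sqrt ((k%:R + 1) * (k%:R + 1 + alpha)) * x k.+1.

Lemma Re_realM (R : realType) (a : R) (z : R[i]) :
  complex.Re (a%:C * z) = a * complex.Re z.
Proof. by case: z => b c /=; rewrite mul0r subr0. Qed.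

Lemma Im_realM (R : realType) (a : R) (z : R[i]) :
  complex.Im (a%:C * z) = a * complex.Im z.
Proof. by case: z => b c /=; rewrite mul0r addr0. Qed.

Lemma Re_laguerre_tau (R : realType) (alpha : R) (u : nat -> R[i]) (k : nat) :
  complex.Re (laguerre_tau alpha u k) =
  laguerre_tau_re alpha (fun j => complex.Re (u j)) k.
Proof.
rewrite /laguerre_tau /laguerre_tau_re raddfB raddfD /= !mulNr raddfN /=.
by rewrite !Re_realM; case: k.
Qed.

Lemma Im_laguerre_tau (R : realType) (alpha : R) (u : nat -> R[i]) (k : nat) :
  complex.Im (laguerre_tau alpha u k) =
  laguerre_tau_re alpha (fun j => complex.Im (u j)) k.
Proof.
rewrite /laguerre_tau /laguerre_tau_re raddfB raddfD /= !mulNr raddfN /=.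
by rewrite !Im_realM; case: k.
Qed.

Lemma sqrtM_amgm (R : realType) (p q x y : R) : 0 <= p -> 0 <= q ->
  2 * (Num.sqrt (p * q) * (x * y)) <= p * x ^+ 2 + q * y ^+ 2.
Proof.
move=> p0 q0; rewrite sqrtrM//.
have := sqr_ge0 (Num.sqrt p * x - Num.sqrt q * y).
rewrite sqrrB !exprMn !sqr_sqrtr//; lra.
Qed.

(** Each induction step drops one square,
    (sqrt(k+1+alpha) x_k - sqrt(k+1) x_(k+1))^2 for k < n and
    (sqrt(k+1) x_k - sqrt(k+1+alpha) x_(k+1))^2 for k >= n.  The part of the
    last diagonal term which the squares have not consumed is
    (N+1+alpha) x_N^2 for the first kind and (N+1) x_N^2 for the second one,
    so the change of kind at n releases alpha x_n^2. *)
Lemma form_lower_bound (R : realType) (alpha : R) (x : nat -> R) (n N : nat) :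
  -1 < alpha ->
  let K : R := N%:R + 1 in
  (if (N < n)%N then (K + alpha) * x N ^+ 2
   else alpha * x n ^+ 2 + K * x N ^+ 2)
  - Num.sqrt (K * (K + alpha)) * (x N * x N.+1)
  <= \sum_(k < N.+1) laguerre_tau_re alpha x k * x k.
Proof.
move=> a1; elim: N => [|N IH] /=.
  rewrite big_ord_recr big_ord0 /laguerre_tau_re /= mulr0 !add0r.
  by case: n => [|n] /=; lra.
rewrite big_ord_recr /=; apply: le_trans (lerD IH (lexx _)).
rewrite /laguerre_tau_re -!natr1 /= {IH}.
set K : R := N%:R + 1; set a := Num.sqrt (K * (K + alpha)).
set a' := Num.sqrt _; set y := x N.+1; set z := x N.+2.
have K1 : 1 <= K by rewrite /K lerDr.
have h1 : 2 * (a * (x N * y)) <= K * x N ^+ 2 + (K + alpha) * y ^+ 2.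
  by apply: sqrtM_amgm; lra.
have h2 : 2 * (a * (x N * y)) <= (K + alpha) * x N ^+ 2 + K * y ^+ 2.
  by rewrite /a [K * _]mulrC; apply: sqrtM_amgm; lra.
have [Nn|Nn|Nn] := ltngtP N.+1 n.
- lra.
- lra.
- rewrite -Nn -/y; lra.
Qed.

(** The growth condition adds up to N s_N >= c (N - M) for N >= M, so that
    s_N >= c / 2 for large N. *)
Lemma no_harmonic_growth (R : realType) (s : R ^nat) (c : R) : 0 < c ->
  (forall N, 0 <= s N) -> s @ \oo --> 0 ->
  ~ (\forall N \near \oo, N%:R * s N + c <= N.+1%:R * s N.+1).
Proof.
move=> c0 s0 cs [M _ hM].
have lin j : j%:R * c <= (M + j)%:R * s (M + j)%N.
  elim: j => [|j IH]; first by rewrite mul0r mulr_ge0.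
  rewrite addnS; apply: le_trans (hM (M + j)%N _) => /=; last exact: leq_addr.
  by rewrite -natr1 mulrDl mul1r lerD2r.
(* The index M + j with j = M + M' + 1 satisfies j / (M + j) >= 1 / 2. *)
have := cvgr_lt _ cs (c / 2) (divr_gt0 c0 (ltr0Sn _ _)).
move=> [M' _ /(_ (M + (M + M').+1)%N)] /=.
have -> : (M' <= M + (M + M').+1)%N by rewrite addnS ltnW// ltnS addnA leq_addl.
move=> /(_ isT) small; have := lin (M + M').+1.
have : 0 <= M%:R :> R by []. have : 0 <= M'%:R :> R by [].
have E : (M + M').+1%:R = M%:R + M'%:R + 1 :> R by rewrite -natr1 natrD.
move: small; rewrite natrD E.
set t := s _; set m := M%:R; set m' := M'%:R => small m'0 m0; nra.
Qed.

Lemma l2_laguerre_perturbed (R : realType) (alpha : R) (n : nat) (v : R)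
    (u : nat -> R[i]) : op_dom (laguerre_perturbed alpha n v) u ->
  l2 (op_act (laguerre_perturbed alpha n v) u).
Proof.
move=> [lu ltu]; rewrite /= l2dot_basis.
have lb : l2 (l2basis R n).
  apply: (@l2_finite_support _ _ n.+1) => k nk.
  by rewrite /l2basis gtn_eqF.
have := l2_lin (- (v%:C * u n)) lb ltu.
by under eq_fun do rewrite mulNr addrC.
Qed.

Lemma Re_laguerre_perturbed_mulJ (R : realType) (alpha : R) (n : nat) (v : R)
    (u : nat -> R[i]) (k : nat) :
  complex.Re (op_act (laguerre_perturbed alpha n v) u k * (u k)^*) =
  laguerre_tau_re alpha (fun j => complex.Re (u j)) k * complex.Re (u k)
  + laguerre_tau_re alpha (fun j => complex.Im (u j)) k * complex.Im (u k)
  - (if k == n then v * abs2 (u n) else 0).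
Proof.
rewrite /= l2dot_basis mulrBl raddfB /= Re_mulJ.
rewrite Re_laguerre_tau Im_laguerre_tau /l2basis; congr (_ - _).
case: eqP => [->|_]; last by rewrite mulr0 mul0r.
by rewrite mulr1 -mulrA Re_realM Re_mulJ_self.
Qed.

Lemma sum_laguerre_perturbed_mulJ (R : realType) (alpha : R) (n : nat) (v : R)
    (u : nat -> R[i]) (N : nat) : (n <= N)%N ->
  series (fun k => complex.Re
    (op_act (laguerre_perturbed alpha n v) u k * (u k)^*)) N.+1 =
  \sum_(k < N.+1)
     laguerre_tau_re alpha (fun j => complex.Re (u j)) k * complex.Re (u k)
  + \sum_(k < N.+1)
     laguerre_tau_re alpha (fun j => complex.Im (u j)) k * complex.Im (u k)
  - v * abs2 (u n).
Proof.
move=> nN; rewrite /series /= big_mkord.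
rewrite (eq_bigr _ (fun (k : 'I_N.+1) _ =>
  Re_laguerre_perturbed_mulJ alpha n v u k)).
rewrite sumrB big_split /=; congr (_ - _).
rewrite -big_mkcond /=; have nN1 : (n < N.+1)%N by [].
by rewrite (big_pred1 (Ordinal nN1)).
Qed.

(** The form is the limit of its partial sums, which form_lower_bound bounds
    below by (alpha - v) |u_n|^2 plus a boundary term at N.  If the limit were
    4 e below (alpha - v) |u_n|^2, the boundary term would eventually be below
    - 3 e, and the arithmetic-geometric mean inequality would turn this into
    N |u_N|^2 + 4 e <= (N + 1) |u_(N+1)|^2. *)
Lemma laguerre_form_ge (R : realType) (alpha : R) (n : nat) (v : R)
    (u : nat -> R[i]) : -1 < alpha -> op_dom (laguerre_perturbed alpha n v) u ->
  (alpha - v) * abs2 (u n) <=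
  complex.Re (l2dot (op_act (laguerre_perturbed alpha n v) u) u).
Proof.
move=> a1 du; have [lu ltu] := du.
have lHu := l2_laguerre_perturbed du.
have cS := l2_cvg_Re_mulJ lHu lu.
rewrite [leRHS]/=; set L := limn _; rewrite leNgt; apply/negP => LQ.
set Q := (alpha - v) * abs2 (u n) in LQ.
pose e := (Q - L) / 4; have e0 : 0 < e by rewrite /e; lra.
have cs : (fun k => abs2 (u k)) @ \oo --> 0.
  exact: cvg_series_cvg_0 (proj1 (l2P u) lu).
have e40 : 0 < 4 * e by lra.
apply: (no_harmonic_growth e40 (fun k => abs2_ge0 (u k)) cs).
have evS : \forall N \near \oo,
    series (fun k => complex.Re
      (op_act (laguerre_perturbed alpha n v) u k * (u k)^*)) N.+1 < L + e.
  have := cvgr_lt _ cS (L + e); rewrite ltrDl => /(_ _ e0) [M _ hM].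
  exists M => // N /= MN; apply: hM => /=; exact: leqW.
have cas : (fun k => `|alpha| * abs2 (u k)) @ \oo --> 0.
  by rewrite -(mulr0 `|alpha|); apply: cvgMr.
have eva : \forall N \near \oo, `|alpha| * abs2 (u N) < e.
  exact: cvgr_lt cas _ e0.
near=> N.
have nN : (n <= N)%N by near: N; exists n.
have hS : series (fun k => complex.Re
      (op_act (laguerre_perturbed alpha n v) u k * (u k)^*)) N.+1 < L + e.
  by near: N.
have ha : `|alpha| * abs2 (u N) < e by near: N.
move: hS; rewrite sum_laguerre_perturbed_mulJ// => hS.
have := form_lower_bound (fun j => complex.Re (u j)) n N a1.
have := form_lower_bound (fun j => complex.Im (u j)) n N a1.
rewrite /= ltnNge nN /= -[N.+1%:R]natr1.
set K : R := N%:R + 1; set r := Num.sqrt _.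
move=> hI hR; have K1 : 1 <= K by rewrite /K lerDr.
have gR := @sqrtM_amgm R (K + alpha) K (complex.Re (u N)) (complex.Re (u N.+1)).
have gI := @sqrtM_amgm R (K + alpha) K (complex.Im (u N)) (complex.Im (u N.+1)).
have Ka0 : 0 <= K + alpha by lra.
have K0 : 0 <= K by lra.
move: (gR Ka0 K0) (gI Ka0 K0) => {gR gI}; rewrite [(_ + alpha) * K]mulrC -/r.
move=> gR gI.
have s0 := abs2_ge0 (u N).
have as0 : alpha * abs2 (u N) <= `|alpha| * abs2 (u N).
  by rewrite ler_wpM2r// ler_norm.
have hK : N%:R * abs2 (u N) <= (K + alpha) * abs2 (u N).
  by rewrite ler_wpM2r// /K; lra.
have Qe : 4 * e = Q - L by rewrite /e; lra.
have QE : alpha * complex.Re (u n) ^+ 2 + alpha * complex.Im (u n) ^+ 2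
          - v * abs2 (u n) = Q by rewrite /Q /abs2; ring.
clearbody e Q L K r; clear -hS ha hI hR gR gI s0 as0 hK Qe QE.
move: hS ha hI hR gR gI s0 as0 hK; rewrite /abs2 in QE *.
lra.
Unshelve. all: by end_near. Qed.

(** * Test vectors of negative energy *)

Lemma harmonic_unbounded (R : realType) (A : R) (n : nat) :
  exists2 N, (n <= N)%N & A < series (@harmonic R) N.
Proof.
have nd : nondecreasing_seq (series (@harmonic R)).
  by apply/nondecreasing_seqP => m; rewrite seriesSr lerDl harmonic_ge0.
apply: contrapT => bnd; apply: (@dvg_harmonic R).
apply: nondecreasing_is_cvgn => //; exists A => _ [N _ <-].
rewrite leNgt; apply/negP => AN; apply: bnd; exists (N + n)%N.
  exact: leq_addl.
by apply: lt_le_trans AN (nd _ _ _); exact: leq_addr.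
Qed.

(** The squares h_k^2 of the solution of tau h = 0 with h_0 = 1. *)
Definition zero_mode_sqr (R : realType) (alpha : R) (k : nat) : R :=
  \prod_(j < k) ((j%:R + 1 + alpha) / (j%:R + 1)).

Lemma zero_mode_sqrS (R : realType) (alpha : R) (k : nat) :
  (k%:R + 1) * zero_mode_sqr alpha k.+1 =
  (k%:R + 1 + alpha) * zero_mode_sqr alpha k.
Proof.
have k1 : k%:R + 1 != 0 :> R by rewrite natr1.
by rewrite /zero_mode_sqr big_ord_recr /=; field.
Qed.

Lemma zero_mode_sqr_gt0 (R : realType) (alpha : R) (k : nat) :
  -1 < alpha -> 0 < zero_mode_sqr alpha k.
Proof.
move=> a1; apply: prodr_gt0 => j _; have : 0 <= j%:R :> R by [].
by move=> j0; rewrite divr_gt0//; lra.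
Qed.

(** For finitely supported u = h p the form of tau is the sum over j of
    (p_j - p_(j+1))^2 / mode_resistance j: the energy of the potential p on a
    chain of resistors. *)
Definition mode_resistance (R : realType) (alpha : R) (j : nat) : R :=
  ((j%:R + 1 + alpha) * zero_mode_sqr alpha j)^-1.

(** When alpha <= 0, h is nonincreasing and the resistances, scaled by h_n^2,
    dominate the harmonic series.  When alpha > 0 they telescope to
    (1 - h_n^2 / h_N^2) / alpha, and h_N^2 >= 1 + alpha (1 + 1/2 + ... + 1/N)
    diverges, so that any v > alpha is enough. *)
Lemma resistance_large (R : realType) (alpha v : R) (n : nat) :
  -1 < alpha -> 0 < v -> alpha <= 0 \/ alpha < v ->
  exists N, 1 < v * zero_mode_sqr alpha n *
                 \sum_(n <= j < N) mode_resistance alpha j.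
Proof.
move=> a1 v0 av; have Hn := zero_mode_sqr_gt0 n a1.
have j0 j : 0 <= j%:R :> R by [].
case: (leP alpha 0) av => [a0 _ | a0 [|av]]; last 1 first.
- set H := zero_mode_sqr alpha.
  have Hge k : 1 + alpha * series (@harmonic R) k <= H k.
    elim: k => [|k IH].
      by rewrite /series /= big_geq// mulr0 addr0 /H /zero_mode_sqr big_ord0.
    have h0 : 0 <= series (@harmonic R) k.
      by apply: sumr_ge0 => i _; exact: harmonic_ge0.
    have kk : 0 < k%:R + 1 :> R by rewrite natr1.
    have H1 : 1 <= H k by apply: le_trans IH; rewrite lerDl mulr_ge0// ltW.
    have -> : H k.+1 = H k + alpha * (k%:R + 1)^-1 * H k.
      apply: (mulfI (lt0r_neq0 kk)); rewrite zero_mode_sqrS -/H.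
      by field; exact: lt0r_neq0.
    rewrite seriesSr /harmonic /= -natr1.
    have i0 : 0 < (k%:R + 1 : R)^-1 by rewrite invr_gt0.
    have : 0 <= alpha * (k%:R + 1)^-1 * (H k - 1).
      by rewrite !mulr_ge0 ?subr_ge0// ltW.
    lra.
  have [N nN hN] := harmonic_unbounded (v * H n / (v - alpha) / alpha) n.
  exists N; have va : 0 < v - alpha by lra.
  have HN0 : 0 < H N by exact: zero_mode_sqr_gt0.
  have HN : v * H n / H N < v - alpha.
    move: hN; rewrite !ltr_pdivrMr// => hN; rewrite [ltRHS]mulrC.
    apply: lt_le_trans hN _; rewrite ler_wpM2r//; first exact: ltW.
    by apply: le_trans (Hge N); rewrite mulrC lerDr.
  have tele : alpha * \sum_(n <= j < N) mode_resistance alpha j =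
              (H n)^-1 - (H N)^-1.
    rewrite -[RHS]opprK opprB -(telescope_sumr (fun k => (H k)^-1))//.
    rewrite -sumrN mulr_sumr.
    apply: eq_bigr => j _; rewrite /mode_resistance -/H.
    have j1 : j%:R + 1 != 0 :> R by rewrite natr1.
    have ja : j%:R + 1 + alpha != 0.
      by have := j0 j => ?; apply: lt0r_neq0; lra.
    have Hj : H j != 0 by apply: lt0r_neq0; exact: zero_mode_sqr_gt0.
    have -> : H j.+1 = (j%:R + 1 + alpha) * H j / (j%:R + 1).
      by rewrite /H -zero_mode_sqrS mulrAC divff// mul1r.
    by field; rewrite j1 Hj ja.
  rewrite -(ltr_pM2l a0) mulr1 mulrCA tele.
  have -> : v * H n * ((H n)^-1 - (H N)^-1) = v - v * H n / H N.
    by field; rewrite !lt0r_neq0.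
  lra.
- have Hanti k : zero_mode_sqr alpha (n + k) <= zero_mode_sqr alpha n.
    elim: k => [|k IH]; first by rewrite addn0.
    rewrite addnS; apply: le_trans IH.
    have nk : 0 < (n + k)%:R + 1 :> R by rewrite natr1.
    rewrite -(ler_pM2l nk) zero_mode_sqrS ler_pM2r ?zero_mode_sqr_gt0//; lra.
  have [N nN hN] := harmonic_unbounded (v^-1 + series (@harmonic R) n) n.
  exists N; rewrite -mulrA -(ltr_pM2l (_ : 0 < v^-1)) ?invr_gt0//.
  rewrite mulr1 mulKf ?lt0r_neq0//.
  have : v^-1 < series (@harmonic R) N - series (@harmonic R) n by lra.
  move=> /lt_le_trans; apply; rewrite sub_series_geq// mulr_sumr.
  rewrite big_nat [leRHS]big_nat; apply: ler_sum => j /andP[nj _].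
  have := j0 j => j0'.
  have ja : 0 < (j%:R + 1 + alpha) * zero_mode_sqr alpha j.
    by rewrite mulr_gt0 ?zero_mode_sqr_gt0//; lra.
  rewrite /mode_resistance /harmonic /= ler_pdivlMr// -natr1 mulrC.
  rewrite ler_pdivrMr; last lra.
  rewrite mulrC; apply: ler_pM; [|lra| |lra].
    exact/ltW/zero_mode_sqr_gt0.
  by rewrite -(subnKC nj).
- by move=> ?; lra.
Qed.

(** Since sqrt(k+1) h_(k+1) = sqrt(k+1+alpha) h_k, the diagonal of tau cancels
    and only increments of p = u / h remain. *)
Lemma tau_zero_mode (R : realType) (alpha : R) (p : nat -> R) (k : nat) :
  -1 < alpha ->
  laguerre_tau_re alpha (fun j => Num.sqrt (zero_mode_sqr alpha j) * p j) k =
  Num.sqrt (zero_mode_sqr alpha k) *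
    ((k%:R + 1 + alpha) * (p k - p k.+1)
     - (if k is j.+1 then k%:R * (p j - p k) else 0)).
Proof.
move=> a1; set s := fun j => Num.sqrt (zero_mode_sqr alpha j).
have j0 (j : nat) : 0 <= j%:R :> R by [].
have up j : Num.sqrt ((j%:R + 1) * (j%:R + 1 + alpha)) * s j.+1 =
            (j%:R + 1 + alpha) * s j.
  have := j0 j => ?; rewrite /s -sqrtrM ?mulr_ge0//; try lra.
  rewrite mulrAC zero_mode_sqrS mulrAC -expr2 sqrtrM ?sqr_ge0//.
  by rewrite sqrtr_sqr ger0_norm//; lra.
have down j : Num.sqrt ((j%:R + 1) * (j%:R + 1 + alpha)) * s j =
              (j%:R + 1) * s j.+1.
  have := j0 j => ?; rewrite /s -sqrtrM ?mulr_ge0//; try lra.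
  rewrite -mulrA -zero_mode_sqrS mulrA -expr2 sqrtrM ?sqr_ge0//.
  by rewrite sqrtr_sqr ger0_norm//; lra.
rewrite /laguerre_tau_re -/(s k).
have -> : Num.sqrt ((k%:R + 1) * (k%:R + 1 + alpha)) * (s k.+1 * p k.+1) =
          (k%:R + 1 + alpha) * s k * p k.+1 by rewrite mulrA up.
case: k => [|k]; first by rewrite mulr0; ring.
by rewrite -[k.+1%:R]natr1 mulNr mulrA -/(s k) down; ring.
Qed.

(** The potential on the chain: constant up to n, and 0 from N on.  The current
    through every link between n and N is 1. *)
Definition truncated_tail (R : realType) (alpha : R) (n N k : nat) : R :=
  \sum_(n <= j < N) if (k <= j)%N then mode_resistance alpha j else 0.

Lemma truncated_tail_eq0 (R : realType) (alpha : R) (n N k : nat) :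
  (N <= k)%N -> truncated_tail alpha n N k = 0.
Proof.
move=> Nk; rewrite /truncated_tail big1_seq// => j.
rewrite mem_index_iota => /andP[_ /andP[_ jN]].
by rewrite leqNgt (leq_trans jN Nk).
Qed.

Lemma truncated_tail_start (R : realType) (alpha : R) (n N : nat) :
  truncated_tail alpha n N n = \sum_(n <= j < N) mode_resistance alpha j.
Proof. by apply: eq_big_nat => j /andP[->]. Qed.

Lemma truncated_tailB (R : realType) (alpha : R) (n N k : nat) :
  truncated_tail alpha n N k - truncated_tail alpha n N k.+1 =
  if (n <= k < N)%N then mode_resistance alpha k else 0.
Proof.
rewrite -(big_nat1_eq +%R (mode_resistance alpha)).
rewrite [RHS]big_mkcond /truncated_tail -sumrB; apply: eq_bigr => j _.
by case: (ltngtP k j) => _ /=; rewrite ?subrr ?subr0.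
Qed.

Definition test_vector (R : realType) (alpha : R) (n N : nat)
    (k : nat) : R[i] :=
  (Num.sqrt (zero_mode_sqr alpha k) * truncated_tail alpha n N k)%:C.

(** The current is constant along the links from n to N, so tau u vanishes
    strictly between n and N as well as below n; u itself vanishes from N on.
    Only the source at n contributes. *)
Lemma test_vector_energy (R : realType) (alpha : R) (n N k : nat) :
  -1 < alpha -> (n < N)%N ->
  laguerre_tau_re alpha (fun j => complex.Re (test_vector alpha n N j)) k
    * complex.Re (test_vector alpha n N k) =
  if k == n then truncated_tail alpha n N n else 0.
Proof.
move=> a1 nN; rewrite /= tau_zero_mode// !truncated_tailB.
have j0 (j : nat) : 0 <= j%:R :> R by [].
have H0 j := zero_mode_sqr_gt0 j a1.
set p := truncated_tail alpha n N; set H := zero_mode_sqr alpha.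
have sH : Num.sqrt (H k) * Num.sqrt (H k) = H k.
  by rewrite -expr2 sqr_sqrtr// ltW.
have {H0} unit j : (j%:R + 1 + alpha) * H j * mode_resistance alpha j = 1.
  have := j0 j => ?; rewrite /mode_resistance mulfV// mulf_neq0//.
    by apply: lt0r_neq0; lra.
  exact: lt0r_neq0.
have flux j : (j%:R + 1 + alpha) * H j *
    (if (n <= j < N)%N then mode_resistance alpha j else 0) =
    (n <= j < N)%N%:R.
  by case: ifP => _; rewrite ?unit// mulr0.
transitivity (p k * ((n <= k < N)%N%:R -
                   (if k is j.+1 then (n <= j < N)%N%:R else 0))).
  rewrite -flux.
  move: (Num.sqrt (H k)) sH => s.
  case: k => [|k] sH; first by rewrite -[in RHS]sH; ring.
  rewrite /p truncated_tailB -/p -[in RHS]flux.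
  rewrite -(zero_mode_sqrS alpha k) -/H -sH.
  by rewrite -[k.+1%:R]natr1; ring.
have [kN|Nk] := ltnP k N; last first.
  rewrite /p truncated_tail_eq0// mul0r; case: eqP => // kn.
  by move: nN; rewrite -kn ltnNge Nk.
clear sH flux; case: (ltngtP k n) => kn.
- case: k kN kn => [|k] kN kn /=; first by rewrite subr0 mulr0.
  by rewrite [(n <= k)%N]leqNgt (ltnW kn) /= subr0 mulr0.
- case: k kN kn => [//|k] kN; rewrite ltnS => nk.
  by rewrite nk (ltnW kN) subrr mulr0.
- rewrite kn; case: n @p kn nN kN => [|m] p kn nN kN /=.
    by rewrite subr0 mulr1.
  by rewrite ltnn /= subr0 mulr1.
Qed.

(** The energy of the test vector is T (1 - v h_n^2 T), where T is the
    resistance between n and N. *)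
Lemma exists_negative_energy (R : realType) (alpha v : R) (n : nat) :
  -1 < alpha -> 0 < v -> alpha <= 0 \/ alpha < v ->
  exists2 u, op_dom (laguerre_perturbed alpha n v) u &
    complex.Re (l2dot (op_act (laguerre_perturbed alpha n v) u) u) < 0.
Proof.
move=> a1 v0 av; have [N] := resistance_large n a1 v0 av.
set T := \sum_(_ <= _ < _) _ => hT.
have nN : (n < N)%N.
  rewrite ltnNge; apply/negP => Nn.
  by move: hT; rewrite /T big_geq// mulr0 ltr10.
have T0 : 0 < T.
  have := zero_mode_sqr_gt0 n a1 => H0; have vH : 0 < v * zero_mode_sqr alpha n.
    exact: mulr_gt0.
  by rewrite -(pmulr_rgt0 _ vH); apply: lt_trans hT.
set u := test_vector alpha n N.
have u0 k : (N <= k)%N -> u k = 0.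
  by move=> Nk; rewrite /u /test_vector truncated_tail_eq0// mulr0.
exists u.
  split; first exact: l2_finite_support u0.
  apply: (@l2_finite_support _ _ N.+1) => k Nk; rewrite /laguerre_tau.
  by case: k Nk => // k Nk; rewrite !u0 ?mulr0 ?addr0 ?subr0// ltnW// ltnW.
rewrite [X in X < _]/= (@limn_series_finite _ _ N.+1); last first.
  by move=> k Nk; rewrite u0 ?rmorph0 ?mulr0// ltnW.
rewrite (sum_laguerre_perturbed_mulJ _ _ _ (ltnW nN)).
have -> : \sum_(k < N.+1) laguerre_tau_re alpha (fun j => complex.Re (u j)) k
            * complex.Re (u k) = T.
  rewrite (eq_bigr _ (fun (k : 'I_N.+1) _ => test_vector_energy k a1 nN)).
  rewrite -big_mkcond /=; have nN1 : (n < N.+1)%N by exact: ltnW.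
  by rewrite (big_pred1 (Ordinal nN1)) ?truncated_tail_start.
rewrite big1 ?addr0; last by move=> k _; rewrite mulr0.
have -> : abs2 (u n) = zero_mode_sqr alpha n * T ^+ 2.
  rewrite /abs2 /u /test_vector /= truncated_tail_start expr0n addr0 exprMn.
  by rewrite sqr_sqrtr// ltW// zero_mode_sqr_gt0.
have -> : T - v * (zero_mode_sqr alpha n * T ^+ 2) =
          T * (1 - v * zero_mode_sqr alpha n * T) by ring.
by rewrite pmulr_rlt0// subr_lt0.
Qed.

(** * Multiplicity of the negative spectrum *)

Theorem lemma5p1 (R : realType) (alpha : R) (n : nat) (v : R)
    (E : set (measurableTypeR R) -> (nat -> R[i]) -> (nat -> R[i]))
    (hv : 0 < v)
    (hE : spectral_measure_of (laguerre_perturbed alpha n v) E) :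
  (-1 < alpha -> alpha <= 0 -> kappa_neg_eq E 1) /\
  (0 < alpha ->
     (v <= alpha -> kappa_neg_eq E 0) /\
     (alpha < v -> kappa_neg_eq E 1)).
Proof.
have rank1 : -1 < alpha -> alpha <= 0 \/ alpha < v -> kappa_neg_eq E 1.
  move=> a1 av; apply: (kappa_neg_eq1 hE (n := n)).
    move=> u du un; have := laguerre_form_ge a1 du.
    by rewrite un /abs2 /= expr0n addr0 mulr0.
  exact: exists_negative_energy.
split=> [a1 a0|a0]; first by apply: rank1 => //; left.
have a1 : -1 < alpha by lra.
split=> av; last by apply: rank1 => //; right.
apply: (kappa_neg_eq0 hE) => u du; apply: le_trans (laguerre_form_ge a1 du).
by rewrite mulr_ge0 ?abs2_ge0// subr_ge0.
Qed.
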